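(* Let $(v_i)_{1\le i\le N}$ be vectors in a (real) Banach space $W$ with dual $W^*$, and set $$\sigma=\Big(\sup\Big\{\sum_{i\le N}w^*(v_i)^2 : w^*\in W^*,\ \|w^*\|\le1\Big\}\Big)^{1/2}.$$ Let $(X_i)_{i\le N}$ be a sequence of independent real valued random variables such that $|X_i|\le1$. Denote by $M$ a median of the random variable $\big\|\sum_{i\le N}X_iv_i\big\|$. Then for $t>0$, $$P\Big(\Big|\,\Big\|\sum_{i\le N}X_iv_i\Big\|-M\Big|\ge t\sigma\Big)\le4\exp\Big(-\frac{t^2}{16}\Big).$$
   Context: The vectors $v_i$ are not all zero (equivalently $\sigma>0$). *)

(* Defs.v *)
From HB Require Import structures.
From mathcomp Require Import all_boot all_order all_algebra.
From mathcomp Require Import all_classical all_reals all_analysis.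

Set Implicit Arguments.
Unset Strict Implicit.
Unset Printing Implicit Defensive.

Import Order.TTheory GRing.Theory Num.Theory.
Import numFieldNormedType.Exports.

Local Open Scope classical_set_scope.
Local Open Scope ring_scope.

(* Operator norm of a functional. [sup] is [0] on unbounded sets, so this is
   meaningful only for continuous [f]. *)
Definition dual_norm (R : realType) (W : normedModType R)
    (f : {linear W -> R^o}) : R :=
  sup [set `|f x| | x in [set x : W | `|x| <= 1]].

Definition dual_ball (R : realType) (W : normedModType R) :
    set {linear W -> R^o} :=
  [set f : {linear W -> R^o} | continuous f /\ dual_norm f <= 1].

(* The set under [sup] is nonempty and bounded above by
   [\sum_i `|v i| ^+ 2]. *)
Definition weak_sigma (R : realType) (W : normedModType R) (N : nat)
    (v : 'I_N -> W) : R :=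
  Num.sqrt (sup [set \sum_(i < N) (f (v i)) ^+ 2 | f in @dual_ball R W]).

Definition independent_RVs (d : measure_display) (T : measurableType d)
    (R : realType) (P : probability T R) (I : finType)
    (X : I -> {RV P >-> R}) : Prop :=
  forall (J : {set I}) (B : I -> set R),
    (forall i, i \in J -> measurable (B i)) ->
    P (\bigcap_(i in [set` J]) (X i @^-1` B i)) =
      (\prod_(i in J) P (X i @^-1` B i))%E.

Definition is_median (d : measure_display) (T : measurableType d)
    (R : realType) (P : probability T R) (Z : T -> R) (M : R) : Prop :=
  (2^-1%:E <= P [set w | (Z w <= M)%R])%E /\
  (2^-1%:E <= P [set w | (M <= Z w)%R])%E.

(* Main.v *)
(** The function [F x = `|\sum_i x i *: v i|] is convex, and by Hahn-Banach
    [l * F x <= l * F y + 4 l^2 sigma^2 + \sum_i (x i - y i)^2 / 16] for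
    [0 <= l]. Maurey's infimum-convolution inequality on the cube [-1, 1]^N
    then bounds [E exp (l F(X)) * E exp (- l F(X))] by [exp (4 l^2 sigma^2)],
    whence [P (F <= a) * P (b <= F) <= exp (4 l^2 sigma^2 - l (b - a))]. With
    [l = t / (8 sigma)] and the median as one of [a], [b], each tail is at most
    [2 exp (- t^2 / 16)]. The product inequality is proved for finitely
    supported laws and transferred by rounding the [X i] to a finite grid, the
    error vanishing in the limit because [F] is Lipschitz. *)

Require Import Defs.
From HB Require Import structures.
From mathcomp Require Import all_boot all_order all_algebra.
From mathcomp Require Import all_classical all_reals all_analysis.
From mathcomp Require Import ring lra.

Import Order.TTheory GRing.Theory Num.Theory.
Import numFieldNormedType.Exports.

Local Open Scope classical_set_scope.
Local Open Scope ring_scope.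

(** * Hahn-Banach theorem *)

Lemma le_infD {R : realType} (A B : set R) (c : R) :
  A !=set0 -> B !=set0 ->
  (forall a b, A a -> B b -> c <= a + b) -> c <= inf A + inf B.
Proof.
move=> A0 B0 cAB; rewrite -lerBlDl; apply: lb_le_inf => // b Bb.
rewrite lerBlDr -lerBlDl; apply: lb_le_inf => // a Aa.
by rewrite lerBlDl addrC; exact: cAB.
Qed.

Lemma le_infM {R : realType} (A : set R) (a c : R) :
  0 < a -> A !=set0 -> (forall x, A x -> c <= a * x) -> c <= a * inf A.
Proof.
move=> a0 A0 cA; rewrite -ler_pdivrMl//; apply: lb_le_inf => // x Ax.
by rewrite ler_pdivrMl//; exact: cA.
Qed.

(** Homogeneity is only an inequality for positive factors, the form that passes to infima;
    [sublinearZ] recovers equality from the inverse factor. *)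
Definition sublinear {R : realType} {W : lmodType R} (q : W -> R) :=
  (forall x y, q (x + y) <= q x + q y) /\
  (forall a x, 0 < a -> q (a *: x) <= a * q x).

Section HahnBanach.
Context {R : realType} {W : lmodType R}.
Implicit Types (p q : W -> R) (x y u : W).

Lemma sublinearZ {q} (a : R) x :
  sublinear q -> 0 < a -> q (a *: x) = a * q x.
Proof.
move=> [_ qZ] a0; apply/eqP; rewrite eq_le qZ//= -ler_pdivlMl//.
by rewrite -{1}[x](scalerK (lt0r_neq0 a0)) qZ// invr_gt0.
Qed.

Lemma sublinear0 {q} : sublinear q -> q 0 = 0.
Proof.
move=> sq; have := @sublinearZ _ 2 0 sq (ltr0Sn _ 1).
by rewrite scaler0 => /eqP; rewrite eq_sym -subr_eq0 -{2}[q 0]mul1r -mulrBl;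
   rewrite mulf_eq0 => /orP[/eqP ? | /eqP //]; lra.
Qed.

Lemma sublinear_geN {q} x : sublinear q -> - q (- x) <= q x.
Proof. by move=> sq; have := sq.1 x (- x); rewrite subrr sublinear0//; lra. Qed.

(* Lowering [q] so that it becomes additive in the direction [u]; the value at
   [- u] is at most [- q u]. *)
Definition lower_along q u x : R :=
  inf [set q (x + s *: u) - s * q u | s in [set s : R | 0 <= s]].

(** Subadditivity bounds the set below by [- q (- x)], so the [inf] is a true infimum and not a
    default value. *)
Lemma lower_along_le {q} u x (s : R) :
  sublinear q -> 0 <= s -> lower_along q u x <= q (x + s *: u) - s * q u.
Proof.
move=> sq s0; apply: ge_inf; last by exists s.
exists (- q (- x)) => _ [r /= r0 <-].
have := sq.1 (x + r *: u) (- x); rewrite addrAC subrr add0r.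
have -> : q (r *: u) = r * q u.
  move: r0; rewrite le_eqVlt => /orP[/eqP <-|r0]; last exact: sublinearZ.
  by rewrite scale0r mul0r sublinear0.
lra.
Qed.

Lemma lower_along_nonempty q u x :
  [set q (x + s *: u) - s * q u | s in [set s : R | 0 <= s]] !=set0.
Proof. by exists (q (x + 0 *: u) - 0 * q u); exists 0 => /=. Qed.

(** Parameters [s] for [x] and [r] for [y] combine into the admissible [s + r] for [x + y], and
    [a * s] is admissible for [a *: x]. *)
Lemma lower_along_sublinear q u :
  sublinear q -> sublinear (lower_along q u).
Proof.
move=> sq; split=> [x y|a x a0].
  apply: le_infD; [exact: lower_along_nonempty|exact: lower_along_nonempty|].
  move=> _ _ [s /= s0 <-] [r /= r0 <-].
  apply: le_trans (lower_along_le _ _ _ sq (addr_ge0 s0 r0)) _.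
  have := sq.1 (x + s *: u) (y + r *: u).
  rewrite addrACA -scalerDl; lra.
apply: le_infM => //; first exact: lower_along_nonempty.
move=> _ [s /= s0 <-].
apply: le_trans (lower_along_le _ _ _ sq (mulr_ge0 (ltW a0) s0)) _.
by rewrite -scalerA -scalerDr (sublinearZ _ _ sq)// mulrBr mulrA.
Qed.

(** Supplies the chain bound for Zorn's lemma. Totality of the chain gives subadditivity: the
    smaller of [q] and [r] serves for both summands. *)
Lemma chain_inf_sublinear p (A : set (W -> R)) : A !=set0 ->
  (forall q, A q -> sublinear q /\ forall x, q x <= p x) ->
  (forall q r, A q -> A r -> (forall x, q x <= r x) \/ forall x, r x <= q x) ->
  let m := fun x => inf [set q x | q in A] in
  sublinear m /\ forall q, A q -> forall x, m x <= q x.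
Proof.
move=> [q0 Aq0] Asub tot m.
have A0 x : [set q x | q in A] !=set0 by exists (q0 x); exists q0.
have m_le q : A q -> forall x, m x <= q x.
  move=> Aq x; apply: ge_inf; last by exists q.
  exists (- p (- x)) => _ [r /= /Asub[sr rp] <-].
  by have := sublinear_geN x sr; have := rp (- x); lra.
split=> //; split=> [x y|a x a0].
  apply: le_infD => // _ _ [q Aq <-] [r Ar <-].
  have [qr|rq] := tot q r Aq Ar.
    by have := m_le q Aq (x + y); have := (Asub q Aq).1.1 x y; move: (qr y); lra.
  by have := m_le r Ar (x + y); have := (Asub r Ar).1.1 x y; move: (rq x); lra.
apply: le_infM => // _ [q Aq <-].
by apply: le_trans (m_le q Aq _) _; exact: (Asub _ Aq).1.2.
Qed.

(** Minimality gives [q x <= lower_along q y x], and the parameter [s = 1] bounds the right side by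
    [q (x + y) - q y]. *)
Lemma minimal_sublinear_additive q : sublinear q ->
  (forall r, sublinear r -> (forall x, r x <= q x) -> forall x, q x <= r x) ->
  forall x y, q (x + y) = q x + q y.
Proof.
move=> sq qmin x y; apply/eqP; rewrite eq_le sq.1/=.
have /qmin := lower_along_sublinear q y sq.
have le_q z : lower_along q y z <= q z.
  by have := lower_along_le y z _ sq (lexx 0); rewrite scale0r addr0 mul0r subr0.
move=> /(_ le_q x) /le_trans/(_ (lower_along_le y x _ sq ler01)).
by rewrite scale1r mul1r; lra.
Qed.

Lemma exists_linear_le p : sublinear p ->
  exists f : {linear W -> R^o}, forall x, f x <= p x.
Proof.
move=> sp.
pose S := {q : W -> R | sublinear q /\ forall x, q x <= p x}.
(* The order is reversed, so that a maximal element is a pointwise minimal sublinear function. *)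
pose ge_fun (s t : S) := `[< forall x, sval t x <= sval s x >].
have [| |A totA|[q [sq qp]] qmin] :=
    @ZL_preorder S (exist _ p (conj sp (fun=> lexx _))) ge_fun.
- by move=> s; apply/asboolP.
- move=> r s t /asboolP sr /asboolP rt; apply/asboolP => x.
  exact: le_trans (rt x) (sr x).
- have [[s0 As0]|A0] := pselect (A !=set0); last first.
    exists (exist _ p (conj sp (fun=> lexx _))) => s As.
    by exfalso; apply: A0; exists s.
  have := @chain_inf_sublinear p [set sval s | s in A].
  case=> [|_ [s As <-]|_ _ [s As <-] [t At <-]|].
  + by exists (sval s0); exists s0.
  + exact: (svalP s).
  + by have [/asboolP|/asboolP] := totA _ _ As At; [right|left].
  move=> sm mle.
  have mp x : inf [set q x | q in [set sval s | s in A]] <= p x.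
    apply: le_trans (mle _ _ x) ((svalP s0).2 x); by exists s0.
  exists (exist (fun r => sublinear r /\ forall x, r x <= p x) _
            (conj sm mp) : S) => s As; apply/asboolP => x /=.
  by apply: mle; exists s.
have qD : forall x y, q (x + y) = q x + q y.
  apply: minimal_sublinear_additive => // r sr rq.
  have rp x : r x <= p x by exact: le_trans (rq x) (qp x).
  have /asboolP := qmin (exist _ r (conj sr rp)) (introT (asboolP _) rq).
  exact.
have qN x : q (- x) = - q x.
  by have := qD x (- x); rewrite subrr sublinear0//; lra.
have qlin : linear (q : W -> R^o).
  move=> a x y; rewrite qD; congr (_ + _).
  have [a0|a0|->] := ltgtP a 0; last by rewrite !scale0r sublinear0.
    by rewrite -[a]opprK scaleNr qN (sublinearZ _ _ sq) ?oppr_gt0// scaleNr.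
  exact: sublinearZ.
pose qL := GRing.isLinear.Build R W R^o _ q qlin.
pose f : {linear W -> R^o} := HB.pack (q : W -> R^o) qL.
by exists f.
Qed.

End HahnBanach.

(** The dominating function is the norm lowered along [u]. Its value at [- u] is at most
    [- normr u], which forces [f u] up to the norm of [u]. *)
Lemma norming_functional (R : realType) (W : normedModType R) (u : W) :
  exists f : {linear W -> R^o}, f u = `|u| /\ forall x, `|f x| <= `|x|.
Proof.
pose q (x : W) := `|x|.
have sq : sublinear q.
  split=> [x y|a x a0]; first exact: ler_normD.
  by rewrite /q normrZ gtr0_norm.
have [f fp] := exists_linear_le _ (lower_along_sublinear q u sq).
have fq x : f x <= `|x|.
  apply: le_trans (fp x) _; apply: le_trans (lower_along_le u x _ sq (lexx 0)) _.
  by rewrite scale0r addr0 mul0r subr0.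
exists f; split.
  apply/eqP; rewrite eq_le fq/= -lerN2 -linearN.
  apply: le_trans (fp _) _; apply: le_trans (lower_along_le u _ _ sq ler01) _.
  by rewrite scale1r addNr /q normr0 mul1r sub0r.
move=> x; rewrite ler_norml fq andbT lerNl -linearN.
by apply: le_trans (fq _) _; rewrite normrN.
Qed.

(** * Infimum-convolution inequality on the cube *)

Lemma two_sub_expRN_ge (R : realType) (u : R) :
  0 <= u -> u <= 1 -> expR (u - u ^+ 2) <= 2 - expR (- u).
Proof.
move=> u0 u1.
pose F (x : R) : R := (2 - expR (- x)) * expR (x ^+ 2 - x).
have dF x : is_derive x (1 : R) (F : R -> R)
    (expR (x ^+ 2 - x) * (expR (- x) + (2 - expR (- x)) * (2 * x - 1))).
  rewrite /F; apply: is_derive_eq.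
  by rewrite /GRing.scale/=; ring.
have F_ge1 : 1 <= F u.
  have <- : F 0 = 1 by rewrite /F oppr0 expr0n/= addr0 expR0; lra.
  apply: (@ger0_derive1_ndecr R F 0 1) => // [x|].
  - rewrite in_itv/= => /andP[x0 x1]; rewrite derive1E derive_val.
    apply: mulr_ge0; first exact: expR_ge0.
    (* With [E := expR (- x) >= 1 - x], the second factor is [2 * (1 - x) * E + 4 * x - 2 >= 2 * x
       ^+ 2]. *)
    by have := expR_ge1Dx (- x); nra.
  - apply: derivable_within_continuous => x _; exact: ex_derive.
have -> : u - u ^+ 2 = - (u ^+ 2 - u) by ring.
by rewrite expRN -div1r ler_pdivrMr// expR_gt0.
Qed.

(* Maurey's property [tau] in dimension one: with [a] a minimizer of [f] on the
   support and [u := f (g k) - f (g a)], test the hypothesis at the point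
   dividing [g k], [g a] in proportion [2 u] if [2 u <= 1], and at [g a]
   otherwise. *)
Lemma inf_convolution_1d (R : realType) (K : finType) (g p h : K -> R)
    (f : R -> R) :
  (forall k, `|g k| <= 1) -> (forall k, 0 <= p k) -> \sum_k p k = 1 ->
  (forall x y c, `|x| <= 1 -> `|y| <= 1 -> 0 <= c <= 1 ->
    f ((1 - c) * x + c * y) <= (1 - c) * f x + c * f y) ->
  (forall k y, `|y| <= 1 -> h k <= f y + (g k - y) ^+ 2 / 16) ->
  (\sum_k p k * expR (h k)) * (\sum_k p k * expR (- f (g k))) <= 1.
Proof.
move=> g1 p0 p1 fconv hf.
have [k0 _|K0] := pickP (@predT K); last first.
  by move: p1; rewrite big_pred0// => /eqP; rewrite eq_sym oner_eq0.
pose a := [arg min_(i < k0) f (g i)]%O.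
have a_min k : f (g a) <= f (g k).
  by rewrite /a; case: arg_minP => // i _; exact.
set m := f (g a) in a_min.
have h_le k : expR (h k - m) <= 2 - expR (- (f (g k) - m)).
  set u := f (g k) - m.
  have u0 : 0 <= u by rewrite subr_ge0.
  have dist_le : (g k - g a) ^+ 2 <= 4.
    by have := g1 k; have := g1 a; rewrite !ler_norml; nra.
  have [u_le|u_ge] := leP u (1 / 2).
    apply: le_trans (two_sub_expRN_ge _ u u0 _); last by lra.
    rewrite ler_expR.
    pose y := (1 - 2 * u) * g k + 2 * u * g a.
    have c01 : 0 <= 2 * u <= 1 by apply/andP; split; lra.
    have y1 : `|y| <= 1.
      by have := g1 k; have := g1 a; rewrite /y !ler_norml; nra.
    have := fconv _ _ _ (g1 k) (g1 a) c01.
    have := hf k y y1; rewrite -/y -/m.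
    have -> : f (g k) = m + u by rewrite /u; ring.
    (* The displacement is [2 * u * (g k - g a)], so the constant [16] makes the cost at most
       [u ^+ 2], while convexity gives [f y <= m + u - 2 * u ^+ 2]. *)
    have -> : (g k - y) ^+ 2 / 16 = u ^+ 2 * ((g k - g a) ^+ 2) / 4.
      by rewrite /y; field.
    have : u ^+ 2 * ((g k - g a) ^+ 2) <= u ^+ 2 * 4.
      by rewrite ler_wpM2l// sqr_ge0.
    rewrite !expr2; lra.
  (* Here [1 / 2 < u]. Testing at [g a] costs at most [4 / 16], which is [u - u ^+ 2] at
     [u = 1 / 2]; the bound at that point suffices since [2 - expR (- u)] increases with [u]. *)
  have h14 : h k - m <= 1 / 2 - (1 / 2) ^+ 2.
    have := hf k _ (g1 a); rewrite -/m !expr2; move: dist_le; rewrite expr2; lra.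
  have u' : expR (- u) <= expR (- (1 / 2)) by rewrite ler_expR; lra.
  have h12 := two_sub_expRN_ge R (1 / 2) ltac:(lra) ltac:(lra).
  have : expR (h k - m) <= expR (1 / 2 - (1 / 2) ^+ 2) by rewrite ler_expR.
  lra.
set z := \sum_k p k * expR (- (f (g k) - m)).
have z0 : 0 <= z by apply: sumr_ge0 => k _; rewrite mulr_ge0// expR_ge0.
have -> : \sum_k p k * expR (h k) = expR m * \sum_k p k * expR (h k - m).
  rewrite big_distrr/=; apply: eq_bigr => k _.
  by rewrite mulrCA -expRD; congr (_ * expR _); ring.
have -> : \sum_k p k * expR (- f (g k)) = expR (- m) * z.
  rewrite big_distrr/=; apply: eq_bigr => k _.
  by rewrite mulrCA -expRD; congr (_ * expR _); ring.
rewrite mulrACA -expRD subrr expR0 mul1r.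
have : \sum_k p k * expR (h k - m) <= 2 - z.
  have -> : 2 = \sum_k p k * 2 :> R by rewrite -big_distrl/= p1 mul1r.
  rewrite -sumrB; apply: ler_sum => k _.
  by rewrite -mulrBr ler_wpM2l.
(* It remains that [(2 - z) * z <= 1]. *)
move=> /(ler_wpM2r z0)/le_trans; apply.
by have := sqr_ge0 (z - 1); rewrite expr2; lra.
Qed.

Definition vcons {A : Type} {n : nat} (a : A) (x : 'I_n -> A) : 'I_n.+1 -> A :=
  fun i => oapp x a (unlift ord0 i).

Lemma vcons0 {A : Type} {n : nat} (a : A) (x : 'I_n -> A) : vcons a x ord0 = a.
Proof. by rewrite /vcons unlift_none. Qed.

Lemma vconsS {A : Type} {n : nat} (a : A) (x : 'I_n -> A) (i : 'I_n) :
  vcons a x (lift ord0 i) = x i.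
Proof. by rewrite /vcons liftK. Qed.

Lemma vconsP {A : Type} {n : nat} (x y : 'I_n.+1 -> A) :
  x ord0 = y ord0 -> (forall i, x (lift ord0 i) = y (lift ord0 i)) -> x =1 y.
Proof. by move=> xy0 xyS i; case: (unliftP ord0 i) => [j ->|->]. Qed.

(** Fubini for product weights, the first coordinate being summed innermost. *)
Lemma sum_ffun_recl (R : comRingType) (K : finType) (n : nat)
    (p : 'I_n.+1 -> K -> R) (Phi : {ffun 'I_n.+1 -> K} -> R) :
  \sum_(k : {ffun 'I_n.+1 -> K}) (\prod_i p i (k i)) * Phi k =
  \sum_(k : {ffun 'I_n -> K}) (\prod_i p (lift ord0 i) (k i)) *
     \sum_s p ord0 s * Phi (finfun (vcons s k)).
Proof.
under [RHS]eq_bigr => k _ do rewrite big_distrr/=.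
rewrite pair_big/=.
rewrite (reindex (fun ks : {ffun 'I_n -> K} * K => finfun (vcons ks.2 ks.1)))/=.
  apply: eq_bigr => -[k s] _ /=.
  rewrite big_ord_recl ffunE vcons0 -!mulrA mulrCA; congr (_ * _).
  by apply: eq_bigr => i _; rewrite ffunE vconsS.
exists (fun k => ([ffun i => k (lift ord0 i)], k ord0)) => [[k s]|k] _ /=.
  congr (_, _); last by rewrite ffunE vcons0.
  by apply/ffunP => i; rewrite !ffunE vconsS.
apply/ffunP => i; rewrite ffunE; apply: vconsP i; first by rewrite vcons0.
by move=> i; rewrite vconsS ffunE.
Qed.

(** * Weighted log-sum-exp: monotonicity and convexity *)

Section LogSumExp.
Context {R : realType} {K : finType} (p : K -> R).
Context (p0 : forall k, 0 <= p k) (p1 : \sum_k p k = 1).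
Implicit Types a b : K -> R.

Definition lse a : R := ln (\sum_k p k * expR (a k)).

(** The argument of [ln] is positive: were the sum zero, every [p k] would vanish, against total
    mass one. *)
Lemma expR_lse a : expR (lse a) = \sum_k p k * expR (a k).
Proof.
have pe0 k : 0 <= p k * expR (a k) by rewrite mulr_ge0// expR_ge0.
rewrite lnK// posrE lt_neqAle sumr_ge0// andbT eq_sym.
apply/eqP => /psumr_eq0P H; have /eqP := p1.
rewrite big1 ?(eq_sym 0) ?oner_eq0// => k _.
have /eqP := H (fun k _ => pe0 k) k isT.
by rewrite mulf_eq0 (gt_eqF (expR_gt0 _)) orbF => /eqP.
Qed.

Lemma le_lse a b (c : R) : (forall k, a k <= b k + c) -> lse a <= lse b + c.
Proof.
move=> ab; rewrite -ler_expR expRD !expR_lse big_distrl/=.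
by apply: ler_sum => k _; rewrite -mulrA -expRD ler_wpM2l// ler_expR.
Qed.

Lemma lse_ge0 a : (forall k, 0 <= a k) -> 0 <= lse a.
Proof.
move=> a0; rewrite -ler_expR expR0 expR_lse -p1; apply: ler_sum => k _.
by rewrite ler_peMr// -expR0 ler_expR.
Qed.

Lemma expR_convex (x y c : R) : 0 <= c <= 1 ->
  expR ((1 - c) * x + c * y) <= (1 - c) * expR x + c * expR y.
Proof.
move=> /andP[c0 c1]; set w := _ + c * y.
have tangent z : expR w * (1 + (z - w)) <= expR z.
  have -> : expR z = expR w * expR (z - w) by rewrite -expRD; congr expR; ring.
  by rewrite ler_wpM2l ?expR_ge0// expR_ge1Dx.
have -> : expR w = (1 - c) * (expR w * (1 + (x - w))) +
                   c * (expR w * (1 + (y - w))) by rewrite /w; ring.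
by apply: lerD; rewrite ler_wpM2l// subr_ge0.
Qed.

(** Hölder's inequality in logarithmic form. Subtracting [lse a] and [lse b] gives both exponentials
    mean one, and convexity of [expR] then bounds the mean of the mixed exponential by one. *)
Lemma lse_convex a b (c : R) : 0 <= c <= 1 ->
  lse (fun k => (1 - c) * a k + c * b k) <= (1 - c) * lse a + c * lse b.
Proof.
move=> c01.
have normalized d : \sum_k p k * expR (d k - lse d) = 1.
  under eq_bigr => k _ do rewrite expRD mulrA.
  by rewrite -big_distrl/= -expR_lse -expRD subrr expR0.
have le1 : \sum_k p k *
    expR ((1 - c) * (a k - lse a) + c * (b k - lse b)) <= 1.
  move: (normalized a) (normalized b); move: (lse a) (lse b) => A B nA nB.
  apply: (@le_trans _ _ ((1 - c) * (\sum_k p k * expR (a k - A)) +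
                         c * (\sum_k p k * expR (b k - B)))); last first.
    by rewrite nA nB; lra.
  rewrite !mulr_sumr -big_split/=; apply: ler_sum => k _.
  apply: le_trans (ler_wpM2l (p0 k) (expR_convex _ _ c c01)) _.
  by move: (expR (a k - A)) (expR (b k - B)) => ea eb; lra.
rewrite -ler_expR expR_lse; set L := (X in expR X).
have := ler_wpM2l (expR_ge0 L) le1; rewrite mulr1; apply: le_trans.
rewrite mulr_sumr le_eqVlt; apply/orP; left; apply/eqP.
apply: eq_bigr => k _; rewrite mulrCA -expRD; congr (_ * expR _).
by rewrite /L; ring.
Qed.

End LogSumExp.

(** * Tensorization of the infimum-convolution inequality *)

Section PropertyTau.
Context {R : realType}.

Definition cube (n : nat) : set ('I_n -> R) := [set x | forall i, `|x i| <= 1].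

Definition convex_on_cube {n : nat} (f : ('I_n -> R) -> R) :=
  forall x y (c : R), cube n x -> cube n y -> 0 <= c <= 1 ->
    f (fun i => (1 - c) * x i + c * y i) <= (1 - c) * f x + c * f y.

Lemma cube_vcons {n : nat} (s : R) (x : 'I_n -> R) :
  `|s| <= 1 -> cube n x -> cube n.+1 (vcons s x).
Proof.
by move=> s1 x1 i; case: (unliftP ord0 i) => [j ->|->]; rewrite ?vconsS ?vcons0.
Qed.

Lemma vcons_conv {n : nat} (s r c : R) (x y : 'I_n -> R) :
  vcons ((1 - c) * s + c * r) (fun i => (1 - c) * x i + c * y i) =
  (fun i => (1 - c) * vcons s x i + c * vcons r y i).
Proof.
by apply/funext; apply: vconsP => [|i]; rewrite ?vcons0 ?vconsS.
Qed.

Definition inf_conv0 {n : nat} (f : ('I_n.+1 -> R) -> R) (x : R)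
    (y : 'I_n -> R) : R :=
  inf [set f (vcons s y) + (x - s) ^+ 2 / 16 | s in [set s : R | `|s| <= 1]].

Section InfConv0.
Context {n : nat} (f : ('I_n.+1 -> R) -> R).
Context (fconv : convex_on_cube f) (f0 : forall x, cube n.+1 x -> 0 <= f x).
Implicit Type y : 'I_n -> R.

Lemma inf_conv0_nonempty (x : R) y :
  [set f (vcons s y) + (x - s) ^+ 2 / 16 | s in [set s : R | `|s| <= 1]] !=set0.
Proof. by eexists; exists 0 => //=; rewrite normr0. Qed.

(** Nonnegativity of [f] on the cube provides the lower bound [0] that makes the [inf] a true
    infimum. *)
Lemma le_inf_conv0 (x s : R) y : cube n y -> `|s| <= 1 ->
  inf_conv0 f x y <= f (vcons s y) + (x - s) ^+ 2 / 16.
Proof.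
move=> y1 s1; apply: ge_inf; last by exists s.
exists 0 => _ [r r1 <-]; rewrite addr_ge0 ?f0//; first exact: cube_vcons.
by rewrite divr_ge0// sqr_ge0.
Qed.

Lemma inf_conv0_ge0 (x : R) y : cube n y -> 0 <= inf_conv0 f x y.
Proof.
move=> y1; apply: lb_le_inf; first exact: inf_conv0_nonempty.
move=> _ [r r1 <-]; rewrite addr_ge0 ?f0//; first exact: cube_vcons.
by rewrite divr_ge0// sqr_ge0.
Qed.

(** The minimized expression is jointly convex in [s] and [y], and partial minimization preserves
    convexity. The endpoints of [c] are treated apart because [le_infM] takes a positive factor. *)
Lemma inf_conv0_convex (x : R) : convex_on_cube (inf_conv0 f x).
Proof.
move=> y z c y1 z1 /andP[].
rewrite le_eqVlt => /orP[/eqP <- _|c0].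
  rewrite subr0 mul1r mul0r addr0 le_eqVlt; apply/orP; left; apply/eqP.
  by congr inf_conv0; apply/funext => i; rewrite mul1r mul0r addr0.
rewrite le_eqVlt => /orP[/eqP ->|c1].
  rewrite subrr mul1r mul0r add0r le_eqVlt; apply/orP; left; apply/eqP.
  by congr inf_conv0; apply/funext => i; rewrite mul1r mul0r add0r.
have c01 : 0 <= c <= 1 by rewrite !ltW.
rewrite -lerBlDl; apply: le_infM => //; first exact: inf_conv0_nonempty.
move=> _ [r /= r1 <-]; rewrite lerBlDr -lerBlDl.
apply: le_infM; rewrite ?subr_gt0//; first exact: inf_conv0_nonempty.
move=> _ [s /= s1 <-]; rewrite lerBlDl.
have w1 : cube n (fun i => (1 - c) * y i + c * z i).
  by move=> i; have := y1 i; have := z1 i; rewrite !ler_norml; nra.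
have sr1 : `|(1 - c) * s + c * r| <= 1 by move: s1 r1; rewrite !ler_norml; nra.
apply: le_trans (le_inf_conv0 x _ _ w1 sr1) _; rewrite vcons_conv.
have := fconv _ _ _ (cube_vcons _ _ s1 y1) (cube_vcons _ _ r1 z1) c01.
have : 0 <= (1 - c) * c * (s - r) ^+ 2.
  by rewrite mulr_ge0 ?sqr_ge0// mulr_ge0 ?subr_ge0 ?ltW.
set A := f _; set B := f _; set D := f _.
(* The defect [(1 - c) * c * (s - r) ^+ 2] is nonnegative, so the quadratic cost is convex in
   [s]. *)
have -> : (x - ((1 - c) * s + c * r)) ^+ 2 =
  (1 - c) * (x - s) ^+ 2 + c * (x - r) ^+ 2 - (1 - c) * c * (s - r) ^+ 2.
  by ring.
nra.
Qed.

End InfConv0.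

(* Maurey's tensorization: integrating the first coordinate out, in the sense of
   [lse], turns [f] into a convex function of the remaining ones. *)
Lemma inf_convolution_cube (K : finType) (g : K -> R) (n : nat)
    (p : 'I_n -> K -> R) (f : ('I_n -> R) -> R) (h : {ffun 'I_n -> K} -> R) :
  (forall k, `|g k| <= 1) ->
  (forall i k, 0 <= p i k) -> (forall i, \sum_k p i k = 1) ->
  convex_on_cube f -> (forall x, cube n x -> 0 <= f x) ->
  (forall k y, cube n y -> h k <= f y + \sum_i (g (k i) - y i) ^+ 2 / 16) ->
  (\sum_(k : {ffun 'I_n -> K}) (\prod_i p i (k i)) * expR (h k)) *
  (\sum_(k : {ffun 'I_n -> K}) (\prod_i p i (k i)) * expR (- f (g \o k))) <= 1.
Proof.
move=> g1; elim: n p f h => [|n IHn] p f h p0 p1 fconv f0 hf.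
  pose k0 := [ffun i : 'I_0 => False_rect K (notF (ltn_ord i))].
  have k0E k : k = k0 by apply/ffunP => -[].
  rewrite !(big_pred1 k0) => [|k|k]; try by rewrite /= [k]k0E eqxx.
  rewrite !big_ord0 !mul1r -expRD -expR0 ler_expR.
  have := hf k0 (g \o k0); rewrite big_ord0 addr0 subr_le0; apply.
  by move=> -[].
pose q s := inf_conv0 f (g s).
pose G y := lse (p ord0) (q^~ y).
pose H (k : {ffun 'I_n -> K}) := lse (p ord0) (fun s => h (finfun (vcons s k))).
have G0 y : cube n y -> 0 <= G y.
  by move=> y1; apply: lse_ge0 => // s; exact: inf_conv0_ge0.
have Gconv : convex_on_cube G.
  move=> x y c x1 y1 c01; apply: le_trans; last exact: lse_convex.
  rewrite -[leRHS]addr0; apply: le_lse => // s; rewrite addr0.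
  exact: inf_conv0_convex.
(* For fixed [s], the hypothesis on [h], less the cost of the last [n] coordinates, gives a lower
   bound of the set whose infimum is [q s y]. *)
have HG k y : cube n y -> H k <= G y + \sum_i (g (k i) - y i) ^+ 2 / 16.
  move=> y1; apply: le_lse => // s; rewrite -lerBlDr.
  apply: lb_le_inf; first exact: inf_conv0_nonempty.
  move=> _ [r /= r1 <-]; rewrite lerBlDr.
  apply: le_trans (hf _ _ (cube_vcons _ _ r1 y1)) _.
  rewrite big_ord_recl ffunE !vcons0 addrA lerD2l.
  by apply: ler_sum => i _; rewrite ffunE !vconsS.
have gk1 (k : {ffun 'I_n -> K}) : cube n (g \o k) by move=> i /=.
have := IHn (fun i => p (lift ord0 i)) G H (fun i => p0 _) (fun i => p1 _)
  Gconv G0 HG.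
apply: le_trans; rewrite !sum_ffun_recl.
apply: ler_pM.
- by do ![apply: sumr_ge0 => * || apply: mulr_ge0 || apply: prodr_ge0 => *];
    rewrite ?expR_ge0.
- by do ![apply: sumr_ge0 => * || apply: mulr_ge0 || apply: prodr_ge0 => *];
    rewrite ?expR_ge0.
- by apply: ler_sum => k _; rewrite expR_lse.
apply: ler_sum => k _; rewrite ler_wpM2l ?prodr_ge0//.
have -> : \sum_s p ord0 s * expR (- f (g \o finfun (vcons s k))) =
          \sum_s p ord0 s * expR (- f (vcons (g s) (g \o k))).
  apply: eq_bigr => s _; congr (_ * expR (- f _)); apply/funext => /=.
  by apply: vconsP => [|i] /=; rewrite ffunE ?vcons0 ?vconsS.
(* Moving [expR (G _)] to the left leaves the one-dimensional inequality for a slice of [f], with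
   [q] as its infimum convolution. *)
rewrite expRN -div1r ler_pdivlMr ?expR_gt0// mulrC expR_lse//.
apply: (inf_convolution_1d _ _ _ _ _ (fun r => f (vcons r (g \o k)))) => //.
- move=> x y c x1 y1 c01; have := fconv _ _ _
    (cube_vcons _ _ x1 (gk1 k)) (cube_vcons _ _ y1 (gk1 k)) c01.
  rewrite -vcons_conv; congr (f (vcons _ _) <= _).
  by apply/funext => i; rewrite -mulrDl subrK mul1r.
- by move=> s y y1; exact: le_inf_conv0.
Qed.

End PropertyTau.

(** * Norms of weighted sums *)

Section WeakSigma.
Context {R : realType} {W : normedModType R}.

(** Continuity bounds [f] on the unit ball, so the supremum in [dual_norm] is not the default [0];
    it is then tested at the normalized [x]. *)
Lemma dual_ball_le (f : {linear W -> R^o}) (x : W) :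
  dual_ball f -> `|f x| <= `|x|.
Proof.
move=> [fcont f1].
have [->|x0] := eqVneq x 0; first by rewrite linear0 !normr0.
have [r rf] : exists r : R, forall y, `|f y| <= r * `|y|.
  have /linear_boundedP fb := (linear_bounded_continuous f).2 fcont.
  by near +oo_R => r; exists r; near: r.
have ub : has_ubound [set `|f y| | y in [set y : W | `|y| <= 1]].
  exists `|r| => _ [y /= y1 <-]; apply: le_trans (rf y) _.
  by have := ler_norm r; have := normr_ge0 r; have := normr_ge0 y; nra.
have nx0 : 0 < `|x| by rewrite normr_gt0.
have : `|f (`|x|^-1 *: x)| <= 1.
  apply: le_trans f1; apply: ub_le_sup => //; exists (`|x|^-1 *: x) => //=.
  by rewrite normrZ normfV normr_id mulVf// gt_eqF.
by rewrite linearZ/= normrZ normfV normr_id mulrC ler_pdivrMr// mul1r.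
Unshelve. all: by end_near. Qed.

Lemma le_dual_ball (f : {linear W -> R^o}) :
  (forall x, `|f x| <= `|x|) -> dual_ball f.
Proof.
move=> f1; split.
  apply: bounded_linear_continuous; apply/linear_boundedP.
  exists 1; split=> [|r r1 x]; first exact: num_real.
  by apply: le_trans (f1 x) _; rewrite ler_peMl// ltW.
apply: ge_sup => [|_ [x /= x1 <-]]; last exact: le_trans (f1 x) x1.
by exists `|f 0|; exists 0 => //=; rewrite normr0.
Qed.

Context {N : nat} (v : 'I_N -> W).

Lemma sum_sqr_le_weak_sigma (f : {linear W -> R^o}) :
  (forall x, `|f x| <= `|x|) ->
  \sum_(i < N) (f (v i)) ^+ 2 <= weak_sigma v ^+ 2.
Proof.
move=> f1.
have le_sup : \sum_(i < N) (f (v i)) ^+ 2 <=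
    sup [set \sum_(i < N) (f (v i)) ^+ 2 | f in @dual_ball R W].
  apply: ub_le_sup; last by exists f => //; exact: le_dual_ball.
  exists (\sum_(i < N) `|v i| ^+ 2) => _ [g /= gB <-].
  apply: ler_sum => i _; rewrite -[leLHS]real_normK ?num_real//.
  by rewrite ler_sqr ?nnegrE// dual_ball_le.
rewrite /weak_sigma sqr_sqrtr//; apply: le_trans le_sup.
by apply: sumr_ge0 => i _; exact: sqr_ge0.
Qed.

(** A functional norming a nonzero [v i] already contributes a positive square. Positivity permits
    the later division by [weak_sigma v]. *)
Lemma weak_sigma_gt0 : (exists i, v i != 0) -> 0 < weak_sigma v.
Proof.
move=> [i vi0]; rewrite lt_neqAle sqrtr_ge0 andbT eq_sym; apply/eqP => s0.
have [f [fvi f1]] := norming_functional R W (v i).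
have := sum_sqr_le_weak_sigma f f1.
rewrite s0 expr0n/= (bigD1 i)//= fvi leNgt ltr_pwDl//.
  by rewrite exprn_gt0// normr_gt0.
by apply: sumr_ge0 => j _; exact: sqr_ge0.
Qed.

Definition sumnorm (x : 'I_N -> R) : R := `|\sum_(i < N) x i *: v i|.

Lemma sumnorm_convex (l : R) : 0 <= l ->
  convex_on_cube (fun x => l * sumnorm x).
Proof.
move=> l0 x y c _ _ /andP[c0 c1]; rewrite !(mulrCA _ l) -mulrDr ler_wpM2l//.
rewrite /sumnorm.
have -> : \sum_(i < N) ((1 - c) * x i + c * y i) *: v i =
   (1 - c) *: (\sum_(i < N) x i *: v i) + c *: (\sum_(i < N) y i *: v i).
  rewrite !scaler_sumr -big_split/=; apply: eq_bigr => i _.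
  by rewrite scalerDl !scalerA.
apply: le_trans (ler_normD _ _) _; rewrite !normrZ.
by rewrite (ger0_norm c0) ger0_norm// subr_ge0.
Qed.

(** This Lipschitz bound controls both the rounding error and the rational approximation behind
    measurability. *)
Lemma sumnorm_dist (x y : 'I_N -> R) (e : R) :
  (forall i, `|x i - y i| <= e) ->
  `|sumnorm x - sumnorm y| <= e * \sum_(i < N) `|v i|.
Proof.
move=> xy; apply: le_trans (ler_dist_dist _ _) _.
rewrite -sumrB mulr_sumr; apply: le_trans (ler_norm_sum _ _ _) _.
by apply: ler_sum => i _; rewrite -scalerBl normrZ ler_wpM2r.
Qed.

(* AM-GM applied to each term of [l * f (\sum_i (x i - y i) *: v i)] for a
   functional [f] norming [\sum_i x i *: v i]. *)
Lemma sumnorm_le_quadratic (l : R) (x y : 'I_N -> R) : 0 <= l ->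
  l * sumnorm x - 4 * l ^+ 2 * weak_sigma v ^+ 2 <=
  l * sumnorm y + \sum_i (x i - y i) ^+ 2 / 16.
Proof.
move=> l0.
have [f [fu f1]] := norming_functional R W (\sum_(i < N) x i *: v i).
have fE z : f (\sum_(i < N) z i *: v i) = \sum_(i < N) z i * f (v i).
  by rewrite linear_sum; apply: eq_bigr => i _; rewrite linearZ.
have fy : \sum_(i < N) y i * f (v i) <= sumnorm y.
  by rewrite -fE; apply: le_trans (ler_norm _) (f1 _).
have fx : sumnorm x = \sum_(i < N) x i * f (v i) by rewrite -fE fu.
have := ler_wpM2l l0 fy; have := sum_sqr_le_weak_sigma f f1.
move=> /(ler_wpM2l (sqr_ge0 l)) sle ley.
have key : l * \sum_(i < N) x i * f (v i) <= l * \sum_(i < N) y i * f (v i) +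
   4 * (l ^+ 2 * \sum_(i < N) f (v i) ^+ 2) + \sum_i (x i - y i) ^+ 2 / 16.
  rewrite !mulr_sumr -!big_split/=; apply: ler_sum => i _.
  have := sqr_ge0 (2 * l * f (v i) - (x i - y i) / 4); rewrite !expr2; lra.
by rewrite fx; lra.
Qed.

(** The cube inequality is applied with [h] equal to [l * sumnorm] minus the constant of
    [sumnorm_le_quadratic]; that constant factors out of the sum. *)
Lemma sumnorm_laplace (K : finType) (g : K -> R) (p : 'I_N -> K -> R) (l : R) :
  (forall k, `|g k| <= 1) ->
  (forall i k, 0 <= p i k) -> (forall i, \sum_k p i k = 1) -> 0 <= l ->
  (\sum_(k : {ffun 'I_N -> K}) (\prod_i p i (k i)) *
     expR (l * sumnorm (g \o k))) *
  (\sum_(k : {ffun 'I_N -> K}) (\prod_i p i (k i)) *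
     expR (- (l * sumnorm (g \o k)))) <= expR (4 * l ^+ 2 * weak_sigma v ^+ 2).
Proof.
move=> g1 p0 p1 l0.
have := inf_convolution_cube K g N p (fun x => l * sumnorm x)
  (fun k => l * sumnorm (g \o k) - 4 * l ^+ 2 * weak_sigma v ^+ 2) g1 p0 p1
  (sumnorm_convex l l0).
have -> : \sum_(k : {ffun 'I_N -> K}) (\prod_i p i (k i)) *
     expR (l * sumnorm (g \o k) - 4 * l ^+ 2 * weak_sigma v ^+ 2) =
   (\sum_(k : {ffun 'I_N -> K}) (\prod_i p i (k i)) *
     expR (l * sumnorm (g \o k))) / expR (4 * l ^+ 2 * weak_sigma v ^+ 2).
  by rewrite mulr_suml; apply: eq_bigr => k _; rewrite expRD expRN mulrA.
move=> tau; rewrite -[leRHS]mul1r -ler_pdivrMr ?expR_gt0// mulrAC; apply: tau.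
  by move=> x _; apply: mulr_ge0 => //; exact: normr_ge0.
by move=> k y _; exact: sumnorm_le_quadratic.
Qed.

(** Exponential Markov bounds for both events with the same [l]; the two Laplace transforms then
    appear as the product in [sumnorm_laplace]. *)
Lemma sumnorm_deviation_discrete (K : finType) (g : K -> R)
    (p : 'I_N -> K -> R) (l a b : R) :
  (forall k, `|g k| <= 1) ->
  (forall i k, 0 <= p i k) -> (forall i, \sum_k p i k = 1) -> 0 <= l ->
  (\sum_(k : {ffun 'I_N -> K} | sumnorm (g \o k) <= a) \prod_i p i (k i)) *
  (\sum_(k : {ffun 'I_N -> K} | b <= sumnorm (g \o k)) \prod_i p i (k i)) <=
  expR (4 * l ^+ 2 * weak_sigma v ^+ 2 - l * (b - a)).
Proof.
move=> g1 p0 p1 l0.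
have m0 (k : {ffun 'I_N -> K}) : 0 <= \prod_i p i (k i) by apply: prodr_ge0.
have markov (Q : pred {ffun 'I_N -> K}) (G : {ffun 'I_N -> K} -> R) :
    (forall k, Q k -> 0 <= G k) ->
    \sum_(k : {ffun 'I_N -> K} | Q k) \prod_i p i (k i) <=
    \sum_(k : {ffun 'I_N -> K}) (\prod_i p i (k i)) * expR (G k).
  move=> QG; rewrite big_mkcond/=; apply: ler_sum => k _.
  have [/QG G0|_] := boolP (Q k); last by rewrite mulr_ge0// expR_ge0.
  by rewrite ler_peMr// -expR0 ler_expR.
have lo := markov (fun k => sumnorm (g \o k) <= a)
  (fun k => l * a + - (l * sumnorm (g \o k))) _.
have hi := markov (fun k => b <= sumnorm (g \o k))
  (fun k => - (l * b) + l * sumnorm (g \o k)) _.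
apply: le_trans (ler_pM _ _ (lo _) (hi _)) _.
- exact: sumr_ge0.
- exact: sumr_ge0.
- by move=> k ka; have := ler_wpM2l l0 ka; lra.
- by move=> k ka; have := ler_wpM2l l0 ka; lra.
have shift c (G : {ffun 'I_N -> K} -> R) :
    \sum_(k : {ffun 'I_N -> K}) (\prod_i p i (k i)) * expR (c + G k) =
    expR c * \sum_(k : {ffun 'I_N -> K}) (\prod_i p i (k i)) * expR (G k).
  by rewrite mulr_sumr; apply: eq_bigr => k _; rewrite expRD mulrCA.
rewrite !shift mulrACA -expRD [X in _ * X]mulrC.
have -> : 4 * l ^+ 2 * weak_sigma v ^+ 2 - l * (b - a) =
  (l * a - l * b) + 4 * l ^+ 2 * weak_sigma v ^+ 2 by ring.
rewrite [leRHS]expRD ler_wpM2l ?expR_ge0//.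
exact: sumnorm_laplace.
Qed.

End WeakSigma.

(** * Rounding and measurability *)

Lemma exists_grid (R : realType) (e : R) : 0 < e ->
  exists (K : finType) (g : K -> R) (D : R -> K),
    [/\ forall k, `|g k| <= 1,
        forall k, measurable (D @^-1` [set k]) &
        forall x, `|x| <= 1 -> `|x - g (D x)| <= e].
Proof.
move=> e0; pose m := (Num.truncn e^-1).+1.
have m0 : 0 < m%:R :> R by rewrite ltr0n.
have me : m%:R^-1 <= e.
  by rewrite -[e]invrK lef_pV2 ?posrE ?invr_gt0// ltW// truncnS_gt.
pose r (x : R) := Num.truncn ((x + 1) * m%:R).
(* The grid has step [1 / m] and contains both ends of [[-1, 1]], hence [2 * m + 1] points; [D]
   rounds down there. *)
exists 'I_(2 * m).+1, (fun k : 'I_(2 * m).+1 => k%:R / m%:R - 1),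
  (fun x => inord (r x)).
split=> [k|k|x].
- have k2m : (k%:R : R) <= 2 * m%:R by rewrite -natrM ler_nat -ltnS.
  have k0 : 0 <= (k%:R : R) by rewrite ler0n.
  have : k%:R / m%:R <= 2 :> R by rewrite ler_pdivrMr.
  have : 0 <= k%:R / m%:R :> R by rewrite divr_ge0// ltW.
  by rewrite ler_norml; lra.
(* Outside the range [inord] takes a default value, so a fiber of [D] may collect infinitely many
   fibers of [r]; the union is countable. *)
- have -> : (fun x => inord (r x)) @^-1` [set k] =
      \bigcup_(j in [set j : nat | inord j = k]) (r @^-1` [set j]).
    apply/seteqP; split=> [x /= xk|x [j /= <- /= -> //]].
    by exists (r x).
  have mle n : measurable [set x | (r x <= n)%N].
    have -> : [set x | (r x <= n)%N] = `]-oo, (n.+1%:R / m%:R - 1)[%classic.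
      apply/seteqP; split=> x /=; rewrite in_itv/= /r truncn_le_nat;
      by rewrite ltrBrDr ltr_pdivlMr.
    exact: measurable_itv.
  apply: bigcup_measurable => -[|j] _.
    have -> : r @^-1` [set 0%N] = [set x | (r x <= 0)%N] by
      apply/seteqP; split=> x /=; rewrite leqn0; move/eqP.
    exact: mle.
  have -> : r @^-1` [set j.+1] =
      [set x | (r x <= j.+1)%N] `\` [set x | (r x <= j)%N].
    apply/seteqP; split=> x /=; first by move=> ->; rewrite leqnn ltnn.
    by move=> [h1 /negP]; rewrite -ltnNge => h2; apply/eqP; rewrite eqn_leq h1.
  exact: measurableD.
- rewrite ler_norml => /andP[x1 x2].
  have y0 : 0 <= (x + 1) * m%:R by rewrite mulr_ge0 ?(ltW m0)//; lra.
  have rx : (r x < (2 * m).+1)%N.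
    rewrite ltnS -(ler_nat R); apply: le_trans (_ : (x + 1) * m%:R <= _).
      by rewrite truncn_le.
    by rewrite natrM ler_wpM2r ?(ltW m0)//; lra.
  rewrite inordK//; apply: le_trans me.
  have /andP[h1 h2] := truncn_itv y0; rewrite -/(r x) -addn1 natrD in h1 h2.
  have -> : x - ((r x)%:R / m%:R - 1) = ((x + 1) * m%:R - (r x)%:R) / m%:R.
    by field; rewrite gt_eqF.
  rewrite normrM normfV (gtr0_norm m0) ler_piMl ?invr_ge0 ?(ltW m0)//.
  by rewrite ler_norml; lra.
Qed.

Section Measurability.
Context {d : measure_display} {T : measurableType d} {R : realType}.
Context {W : normedModType R} {N : nat} (v : 'I_N -> W).
Context (X : 'I_N -> T -> R) (mX : forall i, measurable_fun setT (X i)).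

(** A strict sublevel set becomes a countable union of boxes with rational centres, so measurability
    reduces to the real coordinates and uses no sigma-algebra on [W]. *)
Lemma sumnorm_lt_box (x : 'I_N -> R) (c : R) : sumnorm v x < c <->
  exists (q : {ffun 'I_N -> rat}) (m : nat),
    sumnorm v (fun i => ratr (q i)) + m.+1%:R^-1 * \sum_(i < N) `|v i| < c /\
    forall i, `|x i - ratr (q i)| <= m.+1%:R^-1.
Proof.
have sv0 : 0 <= \sum_(i < N) `|v i| by apply: sumr_ge0.
split=> [xc|[q [m [qc xq]]]]; last first.
  have := sumnorm_dist v x (fun i => ratr (q i)) _ xq.
  by rewrite ler_norml => /andP[_]; move: qc; set e := _^-1 * _; lra.
set s := \sum_(i < N) `|v i| in sv0 *.
(* The error [s / m.+1] must fit twice below the gap: once in moving from [x] to the centre [q],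
   once as the margin required of the box. *)
pose m := Num.truncn ((2 * s + 1) / (c - sumnorm v x)).
have cx : 0 < c - sumnorm v x by rewrite subr_gt0.
have mlt : 2 * (m.+1%:R^-1 * s) < c - sumnorm v x.
  have : (2 * s + 1) / (c - sumnorm v x) < m.+1%:R by exact: truncnS_gt.
  rewrite ltr_pdivrMr// => h.
  by rewrite mulrCA ltr_pdivrMl ?ltr0n//; lra.
have qex i : exists q : rat, `|x i - ratr q| <= m.+1%:R^-1.
  have : 0 < m.+1%:R^-1 :> R by rewrite invr_gt0 ltr0n.
  move: (m.+1%:R^-1) => e e0.
  have /rat_in_itvoo[q] : x i < x i + e by rewrite ltrDl.
  by rewrite in_itv/= => /andP[q1 q2]; exists q; rewrite ler_norml; lra.
pose q := [ffun i => sval (cid (qex i))].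
have xq i : `|x i - ratr (q i)| <= m.+1%:R^-1 by rewrite ffunE; case: cid.
exists q, m; split=> //.
have := sumnorm_dist v x (fun i => ratr (q i)) _ xq.
by rewrite ler_norml => /andP[+ _]; move: mlt; set e := _^-1 * _; lra.
Qed.

Lemma measurable_sumnorm : measurable_fun setT (fun w => sumnorm v (X^~ w)).
Proof.
apply: (measurability _ (measurable_realfun.RGenInftyO.measurableE R)).
move=> _ [_ [c ->] <-].
rewrite setTI.
have -> : (fun w => sumnorm v (X^~ w)) @^-1` `]-oo, c[%classic =
  \bigcup_(qm in [set qm : {ffun 'I_N -> rat} * nat |
      sumnorm v (fun i => ratr (qm.1 i)) +
      qm.2.+1%:R^-1 * \sum_(i < N) `|v i| < c])
   \bigcap_(i in [set: 'I_N])
     (X i @^-1` `[ratr (qm.1 i) - qm.2.+1%:R^-1,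
                  ratr (qm.1 i) + qm.2.+1%:R^-1]%classic).
  apply/seteqP; split=> w /=; rewrite in_itv/=.
    move/sumnorm_lt_box => [q [m [qc xq]]]; exists (q, m) => // i _ /=.
    by have := xq i; rewrite ler_distl in_itv.
  move=> [[q m] /= qc xq]; apply/sumnorm_lt_box; exists q, m; split=> // i.
  by have := xq i I; rewrite /= in_itv/= ler_distl.
rewrite bigcup_mkcond; apply: countable_bigcupT_measurable => [|[q m]].
  exact: countableP.
case: ifP => // _.
apply: fin_bigcap_measurable => // i _.
by rewrite -[X in measurable X]setTI; exact: mX.
Qed.

End Measurability.

(** * Deviation inequality *)

Lemma preimage_fibers {T K : Type} (Y : T -> K) (A : set K) :
  Y @^-1` A = \bigcup_(k in A) (Y @^-1` [set k]).
Proof.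
by apply/seteqP; split=> [w /= Yw|w [k /= Ak Yw]]; [exists (Y w)|rewrite /= Yw].
Qed.

Section Deviation.
Context {d : measure_display} {T : measurableType d} {R : realType}.
Context (P : probability T R).

Lemma probability_preimage (K : finType) (Y : T -> K) (Q : pred K) :
  (forall k, measurable (Y @^-1` [set k])) ->
  P (Y @^-1` [set` Q]) = (\sum_(k | Q k) P (Y @^-1` [set k]))%E.
Proof.
move=> mY.
rewrite preimage_fibers measure_fin_bigcup => [|||k _]//.
- rewrite -(@bigfs _ _ _ _ (index_enum K)) ?index_enum_uniq// => k _.
  by rewrite mem_index_enum.
- by move=> k l _ _ [w [/= <- <-]].
Qed.

Lemma sum_probability_fiber (K : finType) (Y : T -> K) :
  (forall k, measurable (Y @^-1` [set k])) ->
  \sum_k fine (P (Y @^-1` [set k])) = 1.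
Proof.
move=> mY; apply: EFin_inj; rewrite -sumEFin.
under eq_bigr => k _ do rewrite fineK ?fin_num_measure//.
rewrite -probability_preimage// -[RHS](probability_setT P); congr (P _).
by apply/seteqP; split.
Qed.

Context {W : normedModType R} {N : nat} (v : 'I_N -> W).
Context (X : 'I_N -> {RV P >-> R}) (X_indep : independent_RVs X).
Context (X_le1 : forall i, {ae P, forall w, `|X i w| <= 1}).

Let F (w : T) : R := sumnorm v (fun i => X i w).

Lemma measurable_sumnorm_RV : measurable_fun setT F.
Proof. by apply: measurable_sumnorm => i; exact: measurable_funP. Qed.

Lemma measurable_sumnorm_le (a : R) : measurable [set w | F w <= a].
Proof.
rewrite -[X in measurable X]setTI -preimage_itvNyc.
by apply: measurable_sumnorm_RV => //; exact: measurable_itv.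
Qed.

Lemma measurable_sumnorm_ge (b : R) : measurable [set w | b <= F w].
Proof.
rewrite -[X in measurable X]setTI -preimage_itvcy.
by apply: measurable_sumnorm_RV => //; exact: measurable_itv.
Qed.

(** Rounding to the grid moves the norm by at most [e] almost surely, so each threshold is relaxed
    by [e]; independence gives the rounded vector a product law. *)
Lemma sumnorm_deviation_slack (l a b e : R) : 0 <= l -> 0 < e ->
  fine (P [set w | F w <= a]) * fine (P [set w | b <= F w]) <=
  expR (4 * l ^+ 2 * weak_sigma v ^+ 2 - l * ((b - e) - (a + e))).
Proof.
move=> l0 e0.
set s := \sum_(i < N) `|v i|.
have s0 : 0 <= s by apply: sumr_ge0.
have s1 : 0 < s + 1 by rewrite ltr_wpDl.
(* The Lipschitz constant is [s]; the added [1] keeps the divisor positive when [s = 0]. *)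
have [K [g [D [g1 mD gD]]]] := exists_grid _ _ (divr_gt0 e0 s1).
pose p i k := fine (P (X i @^-1` (D @^-1` [set k]))).
have mX i (B : set R) : measurable B -> measurable (X i @^-1` B).
  by move=> mB; rewrite -[X in measurable X]setTI; exact: measurable_funP.
have p0 i k : 0 <= p i k by rewrite fine_ge0// measure_ge0.
have p1 i : \sum_k p i k = 1.
  by apply: (sum_probability_fiber _ (D \o X i)) => k; exact: (mX i _ (mD k)).
pose Y w := [ffun i => D (X i w)].
have YE k : Y @^-1` [set k] =
    \bigcap_(i in [set` [set: 'I_N]%SET]) (X i @^-1` (D @^-1` [set k i])).
  apply/seteqP; split=> w /=; first by move=> <- i _ /=; rewrite ffunE.
  by move=> H; apply/ffunP => i; rewrite ffunE; apply: H; rewrite /= inE.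
have mY k : measurable (Y @^-1` [set k]).
  rewrite YE; apply: fin_bigcap_measurable => // i _.
  exact: (mX i _ (mD (k i))).
have PY k : P (Y @^-1` [set k]) = (\prod_i p i (k i))%:E.
  rewrite YE X_indep// -prodEFin; apply: eq_big => [i|i _]; first by rewrite inE.
  by rewrite fineK// fin_num_measure//; exact: (mX i _ (mD (k i))).
have [B [mB PB0 Bbad]] : {ae P, forall w, forall i, `|X i w| <= 1}.
  exact: filter_forall.
have FY w : ~ B w -> `|F w - sumnorm v (g \o Y w)| <= e.
  move=> nBw; have X1 i : `|X i w| <= 1.
    by apply: contrapT => Xi; apply: nBw; apply: Bbad => /(_ i).
  apply: le_trans (sumnorm_dist v _ _ (e / (s + 1)) _) _ => [i|].
    by rewrite /= ffunE; exact: gD.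
  by rewrite -/s mulrAC ler_pdivrMr// ler_wpM2l ?(ltW e0)//; lra.
(* The null set [B], where some bound on [X i] may fail, is adjoined to the rounded event without
   changing its probability. *)
have PA (A : set T) (Q : pred {ffun 'I_N -> K}) : measurable A ->
    (forall w, A w -> ~ B w -> Q (Y w)) ->
    fine (P A) <= \sum_(k | Q k) \prod_i p i (k i).
  move=> mA AQ; rewrite -lee_fin fineK ?fin_num_measure// -sumEFin.
  under eq_bigr => k _ do rewrite -PY.
  rewrite -probability_preimage//.
  have mQ : measurable (Y @^-1` [set` Q]).
    rewrite preimage_fibers; exact: fin_bigcup_measurable.
  rewrite -(measureU0 mQ mB PB0); apply: le_measure; rewrite ?inE//.
    exact: measurableU.
  by move=> w Aw; have [Bw|nBw] := pselect (B w); [right|left; exact: AQ].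
apply: le_trans
  (sumnorm_deviation_discrete v K g p l (a + e) (b - e) g1 p0 p1 l0).
apply: ler_pM; rewrite ?fine_ge0 ?measure_ge0//.
- apply: PA; first exact: measurable_sumnorm_le.
  by move=> w /= Fw /FY; rewrite ler_norml; lra.
- apply: PA; first exact: measurable_sumnorm_ge.
  by move=> w /= Fw /FY; rewrite ler_norml; lra.
Qed.

Lemma sumnorm_deviation (l a b : R) : 0 <= l ->
  fine (P [set w | F w <= a]) * fine (P [set w | b <= F w]) <=
  expR (4 * l ^+ 2 * weak_sigma v ^+ 2 - l * (b - a)).
Proof.
move=> l0; set x := _ * _; have [x0|x0] := leP x 0.
  exact: le_trans x0 (expR_ge0 _).
(* In logarithms the slack is linear: the choice [e / (2 * l + 1)] costs
   [2 * l * e / (2 * l + 1) <= e]. *)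
rewrite -[x]lnK ?posrE// ler_expR; apply/ler_addgt0Pr => e e0.
have l1 : 0 < 2 * l + 1 by lra.
have := sumnorm_deviation_slack l a b _ l0 (divr_gt0 e0 l1).
rewrite -/x -{1}[x]lnK ?posrE// ler_expR => /le_trans; apply.
have : 2 * l * (e / (2 * l + 1)) <= e.
  by rewrite mulrCA ler_piMr ?(ltW e0)// ler_pdivrMr//; lra.
set r := e / _; lra.
Qed.

End Deviation.

Theorem theorem13p2 (R : realType) (W : completeNormedModType R) (N : nat)
    (v : 'I_N -> W) (v_neq0 : exists i, v i != 0)
    (d : measure_display) (T : measurableType d) (P : probability T R)
    (X : 'I_N -> {RV P >-> R}) (X_indep : independent_RVs X)
    (X_le1 : forall i, {ae P, forall w, `|X i w| <= 1})
    (M : R) (M_median : is_median P (fun w => `|\sum_(i < N) X i w *: v i|) M)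
    (t : R) (t_gt0 : 0 < t) :
  (P [set w | (t * weak_sigma v <=
               `| `|\sum_(i < N) X i w *: v i| - M |)%R]
     <= (4 * expR (- (t ^+ 2 / 16)))%:E)%E.
Proof.
have s0 := weak_sigma_gt0 v v_neq0.
set s := weak_sigma v in s0 *.
pose F w := `|\sum_(i < N) X i w *: v i|.
(* This is the minimizer of [4 * l ^+ 2 * s ^+ 2 - l * (t * s)] in [l]. *)
pose l := t / (8 * s).
have l0 : 0 <= l by rewrite divr_ge0 ?(ltW t_gt0)// mulr_ge0// ltW.
have exponentE : 4 * l ^+ 2 * s ^+ 2 - l * (t * s) = - (t ^+ 2 / 16).
  by rewrite /l; field; rewrite gt_eqF.
have mle a : measurable [set w | F w <= a] := measurable_sumnorm_le P v X a.
have mge b : measurable [set w | b <= F w] := measurable_sumnorm_ge P v X b.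
have [Mle Mge] := M_median.
have half A : (2^-1%:E <= P A)%E -> measurable A -> 2^-1 <= fine (P A).
  by move=> PA mA; rewrite -lee_fin fineK// fin_num_measure.
have hi := sumnorm_deviation P v X X_indep X_le1 l M (M + t * s) l0.
have lo := sumnorm_deviation P v X X_indep X_le1 l (M - t * s) M l0.
have hiE : M + t * s - M = t * s by ring.
have loE : M - (M - t * s) = t * s by ring.
rewrite hiE -/s exponentE in hi; rewrite loE -/s exponentE in lo.
have -> : [set w | t * s <= `|F w - M|] =
    [set w | M + t * s <= F w] `|` [set w | F w <= M - t * s].
  apply/seteqP; split=> w /=.
    by rewrite ler_normr => /orP[h|h]; [left|right]; lra.
  by rewrite ler_normr => -[h|h]; apply/orP; [left|right]; lra.
apply: (@le_trans _ _ (P [set w | (M + t * s <= F w)%R] +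
                       P [set w | (F w <= M - t * s)%R])%E).
  exact: measureU2.
rewrite -(fineK (fin_num_measure P _ (mge _))).
rewrite -(fineK (fin_num_measure P _ (mle _))) -EFinD lee_fin.
have hM := half _ Mle (mle M); have hM' := half _ Mge (mge M).
have hi0 : 0 <= fine (P [set w | M + t * s <= F w]) by exact: fine_ge0.
have lo0 : 0 <= fine (P [set w | F w <= M - t * s]) by exact: fine_ge0.
(* In each product the factor at the median is at least one half, so each tail is at most twice the
   exponential. *)
have := le_trans (ler_wpM2r hi0 hM) hi.
have := le_trans (ler_wpM2l lo0 hM') lo.
lra.
Qed.
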